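(* Let $N\in\mathbb{N}$, $N\ge1$, let $X=\{x_1<x_2<\dots<x_N\}\subset(0,1)$ and let $\varepsilon>0$. Then for all $f\in C(0,1)$ it holds $$\|I_{1,\varepsilon,X}f-I_{1,0,X}f\|_{L_\infty(0,1)}\le\frac{8}{3}\,\varepsilon^2\,h_X^2\,\|f_{|X}\|_\infty .$$
   Context: The Brownian Bridge kernels $k_{1,\varepsilon}:(0,1)^2\to\mathbb{R}$, $\varepsilon\ge0$, are $$k_{1,0}(x,y)=\min(x,y)-xy,\qquad k_{1,\varepsilon}(x,y)=\frac{\sinh(\varepsilon\min(x,y))\,\sinh(\varepsilon(1-\max(x,y)))}{\varepsilon\sinh(\varepsilon)}\ \ (\varepsilon>0),\quad x,y\in(0,1).$$ They are strictly positive definite on $(0,1)$. For $\varepsilon\ge0$ and $f\in C(0,1)$ (continuous real functions on $(0,1)$), $I_{1,\varepsilon,X}f$ denotes the unique element of $\operatorname{span}\{k_{1,\varepsilon}(\cdot,x):x\in X\}$ with $I_{1,\varepsilon,X}f(x_i)=f(x_i)$ for $1\le i\le N$. With $x_0:=0$, $x_{N+1}:=1$, $h_i:=x_{i+1}-x_i$ for $0\le i\le N$, the fill distance is $h_X:=\max_{x\in(0,1)}\min_{0\le i\le N+1}|x-x_i|=\frac12\max_{0\le i\le N}h_i$. Finally $\|f_{|X}\|_\infty:=\max_{1\le i\le N}|f(x_i)|$. *)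

(* Defs.v *)
From mathcomp Require Import all_boot all_order all_algebra.
From mathcomp Require Import all_classical all_reals all_analysis.
Import Order.TTheory GRing.Theory Num.Theory.
Import numFieldNormedType.Exports.

Set Implicit Arguments.
Unset Strict Implicit.
Unset Printing Implicit Defensive.

Local Open Scope classical_set_scope.
Local Open Scope ring_scope.

Definition sinh {R : realType} (x : R) : R := (expR x - expR (- x)) / 2.

(* Only the values at x, y in ]0, 1[ and eps >= 0 are meaningful; elsewhere the
   same formulas are used, so that kernel translates are functions on R. *)
Definition bridge_kernel {R : realType} (eps x y : R) : R :=
  if eps == 0 then Num.min x y - x * y
  else sinh (eps * Num.min x y) * sinh (eps * (1 - Num.max x y))
       / (eps * sinh eps).

Definition kernel_span {R : realType} (k : R -> R -> R) (X : seq R) :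
    set (R -> R) :=
  [set s | exists c : R -> R, s = (fun t => \sum_(x <- X) c x * k t x)].

Definition interpolates {R : realType} (k : R -> R -> R) (X : seq R)
    (f s : R -> R) : Prop :=
  kernel_span k X s /\ {in X, forall x, s x = f x}.

(* The interpolant. For a strictly positive definite k and pairwise distinct
   points X it exists and is unique, and this definition selects it. *)
Definition interpolant {R : realType} (k : R -> R -> R) (X : seq R)
    (f : R -> R) : R -> R :=
  get (interpolates k X f).

(* The points x_0 = 0, x_1, ..., x_N, x_{N+1} = 1. *)
Definition nodes {R : realType} (X : seq R) : seq R := 0 :: rcons X 1.

(* The seed `|t| of the iterated minimum is `|t - x_0|, itself one of the
   terms. *)
Definition dist_to_nodes {R : realType} (X : seq R) (t : R) : R :=
  \big[Num.min/`|t|]_(y <- nodes X) `|t - y|.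

Definition fill_distance {R : realType} (X : seq R) : R :=
  sup [set dist_to_nodes X t | t in `]0, 1[%classic].

Definition max_norm_on {R : realType} (X : seq R) (f : R -> R) : R :=
  \big[Num.max/0]_(x <- X) `|f x|.

(* Extension by zero outside ]0, 1[ does not change the essential supremum of
   the absolute value. *)
Definition Linfty_norm {R : realType} (g : R -> R) : \bar R :=
  ('N[@lebesgue_measure R]_+oo [(EFin \o g) \_ `]0%R, 1%R[])%E.

(* Main.v *)
(* Between adjacent nodes a < b both interpolants are blends of the same end
   values: linear for eps = 0, with weights sinh (eps * (b - t)) / sinh (eps *
   (b - a)) and sinh (eps * (t - a)) / sinh (eps * (b - a)) for eps > 0; at the
   extra nodes 0 and 1 both vanish. By convexity of sinh each hyperbolic weight
   lies below the corresponding linear one, so the difference is at most the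
   maximum of the data times 1 minus the sum of the hyperbolic weights. That
   quantity is at most (eps * (b - a) / 2) ^ 2 <= (eps * h_X) ^ 2, which yields
   the constant 1 in place of 8/3. *)
Require Import Defs.
From mathcomp Require Import all_boot all_order all_algebra.
From mathcomp Require Import all_classical all_reals all_analysis.
From mathcomp Require Import ess_sup_inf ring lra.
Import Order.TTheory GRing.Theory Num.Theory.
Import numFieldNormedType.Exports.
Set Implicit Arguments.
Unset Strict Implicit.
Unset Printing Implicit Defensive.

Local Open Scope classical_set_scope.
Local Open Scope ring_scope.

(** * Hyperbolic functions: addition formulas and convexity estimates *)

Definition cosh {R : realType} (x : R) : R := (expR x + expR (- x)) / 2.

Section Hyperbolic.
Context {R : realType}.
Implicit Types x y z a b t : R.

Lemma sinh0 : sinh (0 : R) = 0.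
Proof. by rewrite /sinh oppr0 subrr mul0r. Qed.

Lemma sinh_lt : {homo @sinh R : x y / x < y}.
Proof.
move=> x y xy; have := xy; rewrite -ltr_expR => exy.
have : expR (- y) < expR (- x) by rewrite ltr_expR ltrN2.
by rewrite /sinh; lra.
Qed.

Lemma sinh_gt0 x : 0 < x -> 0 < sinh x.
Proof. by move=> /sinh_lt; rewrite sinh0. Qed.

Lemma sinh_ge0 x : 0 <= x -> 0 <= sinh x.
Proof. by rewrite le_eqVlt => /predU1P[<-|/sinh_gt0/ltW//]; rewrite sinh0. Qed.

Lemma sinhD x y : sinh (x + y) = sinh x * cosh y + cosh x * sinh y.
Proof. by rewrite /sinh /cosh opprD !expRD; field. Qed.

Lemma coshD x y : cosh (x + y) = cosh x * cosh y + sinh x * sinh y.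
Proof. by rewrite /sinh /cosh opprD !expRD; field. Qed.

Lemma sinhN x : sinh (- x) = - sinh x.
Proof. by rewrite /sinh opprK; field. Qed.

Lemma coshN x : cosh (- x) = cosh x.
Proof. by rewrite /cosh opprK addrC. Qed.

Lemma cosh2_sinh2 x : cosh x ^+ 2 - sinh x ^+ 2 = 1.
Proof.
by rewrite /cosh /sinh -[RHS](@expR0 R) -(subrr x) expRD; field.
Qed.

Lemma cosh_ge1 x : 1 <= cosh x.
Proof.
have c0 : 0 < cosh x by rewrite /cosh divr_gt0// addr_gt0// expR_gt0.
have := cosh2_sinh2 x; nra.
Qed.

Lemma cosh_le x y : 0 <= x -> x <= y -> cosh x <= cosh y.
Proof.
move=> x0 xy; rewrite -(subrK x y) coshD.
have sx := sinh_ge0 x0.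
have syx : 0 <= sinh (y - x) by rewrite sinh_ge0// subr_ge0.
have := cosh_ge1 x; have := cosh_ge1 (y - x); nra.
Qed.

Lemma is_derive_sinh x : is_derive x 1 sinh (cosh x).
Proof.
rewrite /cosh; apply: is_derive_eq.
by rewrite /GRing.scale/=; field.
Qed.

Lemma sinh_MVT x y : x < y ->
  exists2 c, x < c < y & sinh y - sinh x = cosh c * (y - x).
Proof.
move=> xy; have [||c] := @MVT R sinh cosh x y xy.
- by move=> z _; exact: is_derive_sinh.
- apply: derivable_within_continuous => z _; have := is_derive_sinh z.
  by move=> [].
- by rewrite in_itv/= => cxy ?; exists c.
Qed.

(* By convexity of sinh on the nonnegative reals, its mean slope over [0, x] is
   at most its mean slope over [x, y]. *)
Lemma sinh_chord_le x y : 0 <= x -> x <= y -> y * sinh x <= x * sinh y.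
Proof.
rewrite le_eqVlt => /predU1P[<-|x0]; first by rewrite sinh0 mulr0 mul0r.
rewrite le_eqVlt => /predU1P[<-//|xy].
have [c /andP[c0 cx]] := sinh_MVT x0; rewrite sinh0 !subr0 => sx.
have [d /andP[dx dy] syx] := sinh_MVT xy.
have cd : cosh c <= cosh d by apply: cosh_le; lra.
have -> : sinh y = cosh d * (y - x) + cosh c * x by rewrite -sx -syx subrK.
rewrite sx -subr_ge0.
have -> : x * (cosh d * (y - x) + cosh c * x) - y * (cosh c * x) =
    x * (y - x) * (cosh d - cosh c) by ring.
by rewrite !mulr_ge0 ?subr_ge0 ?(ltW x0) ?(ltW xy).
Qed.

(* cosh z - 1 = expR z * (1 - expR (- z)) ^+ 2 / 2, and 1 - expR (- z) <= z. *)
Lemma cosh_quadratic z : 0 <= z -> (1 - z ^+ 2) * cosh z <= 1.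
Proof.
move=> z0; rewrite /cosh.
have := expR_ge1Dx (- z); have : expR (- z) <= 1 by rewrite -expR0 ler_expR; lra.
have := expR_gt0 z; have : expR z * expR (- z) = 1 by rewrite -expRD subrr expR0.
set E := expR z; set E' := expR (- z) => EE' E0 E'1 zE'.
have E'0 : 0 < E' by exact: expR_gt0.
have h1 : (1 - E') ^+ 2 <= z ^+ 2 by nra.
have h2 : E * (1 - E') ^+ 2 <= E * z ^+ 2 by rewrite ler_wpM2l// ltW.
have h3 : E * (1 - E') ^+ 2 = E + E' - 2.
  by transitivity (E - 2 * (E * E') + (E * E') * E'); [ring|rewrite EE'; ring].
(* Enlarges the bound [E + E' - 2 <= E * z ^+ 2] to [(E + E') * z ^+ 2], a multiple of [cosh z]. *)
have h4 : 0 <= E' * z ^+ 2 by rewrite mulr_ge0// ?sqr_ge0// ltW.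
lra.
Qed.

(** With [z] the half sum and [d] the half difference, the right side is
    [2 * sinh z * cosh d >= 2 * sinh z], while [sinh (x + y) = 2 * sinh z * cosh z];
    [cosh_quadratic] closes the gap. This bounds the sum of the hyperbolic weights from below. *)
Lemma sinh_add_ge x y : 0 <= x -> 0 <= y ->
  (1 - ((x + y) / 2) ^+ 2) * sinh (x + y) <= sinh x + sinh y.
Proof.
move=> x0 y0; set z := (x + y) / 2; set d := (x - y) / 2.
have -> : sinh x + sinh y = 2 * (sinh z * cosh d).
  have -> : x = z + d by rewrite /z/d; field.
  have -> : y = z - d by rewrite /z/d; field.
  by rewrite !sinhD sinhN coshN; ring.
have -> : x + y = z + z by rewrite /z; field.
rewrite sinhD.
have z0 : 0 <= z by rewrite /z; lra.
have s0 := sinh_ge0 z0.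
have c1 := cosh_quadratic z0; have d1 := cosh_ge1 d.
have : sinh z * ((1 - z ^+ 2) * cosh z) <= sinh z * cosh d.
  by rewrite ler_wpM2l//; lra.
lra.
Qed.

End Hyperbolic.

(** * Kernel spans for both kernels at once: local form and interpolation *)

Section Kernel.
Context {R : realType}.
Implicit Types (sg f s : R -> R) (w : R) (X : seq R).

(* [sg = id] gives the kernel for [eps = 0], [sg = sinh (eps * _)] the one for
   [eps > 0]. The functional equation says that [sg], and hence also
   [t |-> sg (1 - t)], is determined on an interval [a, b] by its values at [a]
   and [b]. *)
Definition bridge_profile sg := [/\ sg 0 = 0, {homo sg : x y / x < y} &
  forall a b t, sg (b - a) * sg t = sg (b - t) * sg a + sg (t - a) * sg b].

Definition profile_kernel sg w (t x : R) :=
  sg (Num.min t x) * sg (1 - Num.max t x) * w.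

Lemma profile_id : bridge_profile id.
Proof. by split => // a b t; ring. Qed.

Lemma profile_sinh eps : 0 < eps -> bridge_profile (fun x => sinh (eps * x)).
Proof.
move=> e0; split=> [|x y xy|a b t]; first by rewrite mulr0 sinh0.
  by apply: sinh_lt; rewrite ltr_pM2l.
by rewrite !mulrBr !sinhD !sinhN !coshN; ring.
Qed.

Lemma bridge_kernel0E : bridge_kernel 0 = profile_kernel (@id R) 1.
Proof.
apply/funext => t; apply/funext => x; rewrite /bridge_kernel eqxx.
by rewrite /profile_kernel; case: ltP => _; ring.
Qed.

Lemma bridge_kernelE (eps : R) : 0 < eps -> bridge_kernel eps =
  profile_kernel (fun x => sinh (eps * x)) (eps * sinh eps)^-1.
Proof.
by move=> e0; apply/funext => t; apply/funext => x; rewrite /bridge_kernel gt_eqF.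
Qed.

Lemma profile_kernel_le sg w t x : t <= x ->
  profile_kernel sg w t x = sg t * sg (1 - x) * w.
Proof. by move=> tx; rewrite /profile_kernel min_l// max_r. Qed.

Lemma profile_kernel_ge sg w t x : x <= t ->
  profile_kernel sg w t x = sg x * sg (1 - t) * w.
Proof. by move=> tx; rewrite /profile_kernel min_r// max_l. Qed.

(** On [[a, b]] a translate centred outside the open interval is a multiple of [sg t] or of
    [sg (1 - t)], and both satisfy the functional equation. *)
Lemma kernel_span_between sg w X s a b t : bridge_profile sg ->
  kernel_span (profile_kernel sg w) X s -> a <= t <= b ->
  {in X, forall x, x <= a \/ b <= x} ->
  sg (b - a) * s t = sg (b - t) * s a + sg (t - a) * s b.
Proof.
move=> [_ _ sgE] [c ->] /andP[ta tb] Xab.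
rewrite !mulr_sumr -big_split/=; apply: eq_big_seq => x /Xab[xa|bx].
- have ab := le_trans ta tb.
  rewrite !profile_kernel_ge//; [|exact: le_trans xa _..].
  (* The functional equation reflected by [t |-> 1 - t], which swaps the ends. *)
  have := sgE (1 - b) (1 - a) (1 - t).
  have -> : 1 - a - (1 - b) = b - a by ring.
  have -> : 1 - a - (1 - t) = t - a by ring.
  have -> : 1 - t - (1 - b) = b - t by ring.
  move=> e; transitivity (sg (b - a) * sg (1 - t) * (c x * sg x * w)); first ring.
  by rewrite e; ring.
- have ab := le_trans ta tb.
  rewrite !profile_kernel_le//; [|exact: le_trans bx..].
  transitivity (sg (b - a) * sg t * (c x * sg (1 - x) * w)); first ring.
  by rewrite sgE; ring.
Qed.

(** Lets 0 and 1 serve as extra nodes at which both interpolants have the value 0. *)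
Lemma kernel_span_boundary sg w X s : bridge_profile sg ->
  kernel_span (profile_kernel sg w) X s -> {in X, forall x, 0 < x < 1} ->
  s 0 = 0 /\ s 1 = 0.
Proof.
move=> [sg0 _ _] [c ->] X01; split; apply: big1_seq => x /= /X01 /andP[x0 x1].
  by rewrite profile_kernel_le ?sg0 ?(ltW x0)//; ring.
by rewrite profile_kernel_ge ?(ltW x1)// subrr sg0; ring.
Qed.

Lemma kernel_span_lincomb (k : R -> R -> R) X a s1 s2 :
  kernel_span k X s1 -> kernel_span k X s2 ->
  kernel_span k X (fun t => s1 t + a * s2 t).
Proof.
move=> [c ->] [d ->]; exists (fun x => c x + a * d x); apply/funext => t.
by rewrite mulr_sumr -big_split/=; apply: eq_bigr => x _; ring.
Qed.

Lemma kernel_span_cons (k : R -> R -> R) x X s : x \notin X ->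
  kernel_span k X s -> kernel_span k (x :: X) s.
Proof.
(* The value of [c] at the new point is arbitrary, so it is reset to 0. *)
move=> xX [c ->]; exists (fun y => if y == x then 0 else c y).
apply/funext => t; rewrite big_cons eqxx mul0r add0r.
apply: eq_big_seq => y yX; case: eqP => // yx.
by rewrite -yx yX in xX.
Qed.

Lemma kernel_span_head (k : R -> R -> R) x X : x \notin X ->
  kernel_span k (x :: X) (k ^~ x).
Proof.
move=> xX; exists (fun y => (y == x)%:R); apply/funext => t.
rewrite big_cons eqxx mul1r big1_seq ?addr0// => y /= yX.
by case: eqP => [yx|]; rewrite ?mul0r//; rewrite -yx yX in xX.
Qed.

(* For t >= y the translates at x and y are both multiples of sg (1 - t), so
   one combination of them vanishes on all later nodes; it is nonzero at x. *)
Lemma profile_cardinal sg w x X : bridge_profile sg -> w != 0 ->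
  sorted <%R (x :: X) -> {in x :: X, forall y, 0 < y < 1} ->
  exists2 s, kernel_span (profile_kernel sg w) (x :: X) s &
    s x != 0 /\ {in X, forall y, s y = 0}.
Proof.
move=> [sg0 sglt _] w0; have sgp u : 0 < u -> 0 < sg u by move=> /sglt; rewrite sg0.
case: X => [|y X] srt X01.
  have /andP[x0 x1] := X01 x (mem_head _ _).
  exists (profile_kernel sg w ^~ x); first exact: kernel_span_head.
  split => //; rewrite profile_kernel_le// !mulf_neq0// gt_eqF// sgp//; lra.
have /andP[x0 x1] := X01 x (mem_head _ _).
have /andP[y0 y1] : 0 < y < 1 by apply: X01; rewrite !inE eqxx orbT.
have := srt; rewrite /= => /andP[xy srt'].
have xX : x \notin y :: X.
  by have := sorted_uniq lt_trans ltxx srt; rewrite /= => /andP[].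
have yX : y \notin X.
  by have := sorted_uniq lt_trans ltxx srt; rewrite /= => /and3P[].
exists (fun t => profile_kernel sg w t x
                 + - (sg x / sg y) * profile_kernel sg w t y).
  apply: kernel_span_lincomb; first exact: kernel_span_head.
  by apply: kernel_span_cons => //; exact: kernel_span_head.
have sy := sgp _ y0; split.
  rewrite !profile_kernel_le ?(ltW xy)//.
  (* Nonvanishing at [x] becomes [sg x * sg (1 - y) < sg y * sg (1 - x)], which follows from strict
     monotonicity. *)
  have -> : sg x * sg (1 - x) * w + - (sg x / sg y) * (sg x * sg (1 - y) * w) =
      sg x * w / sg y * (sg y * sg (1 - x) - sg x * sg (1 - y)).
    by field; rewrite gt_eqF.
  have sx := sgp _ x0.
  have lt1 : sg x < sg y by exact: sglt.
  have lt2 : sg (1 - y) < sg (1 - x) by apply: sglt; lra.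
  have s1y : 0 < sg (1 - y) by apply: sgp; lra.
  rewrite !mulf_neq0 ?invr_neq0 ?(gt_eqF sx) ?(gt_eqF sy)//.
  by rewrite subr_eq0 gt_eqF// ltr_pM ?(ltW sx) ?(ltW s1y).
move=> z zX; have yz : y <= z.
  move: zX; rewrite inE => /predU1P[->//|zX].
  by have /allP/(_ _ zX)/ltW := order_path_min lt_trans srt'.
rewrite !profile_kernel_ge//; last exact: le_trans (ltW xy) yz.
by field; rewrite gt_eqF.
Qed.

(** Newton-style induction: interpolate on the tail, then correct the value at the head by a
    function vanishing on the tail. Existence ensures that [get] returns a genuine interpolant. *)
Lemma interpolates_exists sg w X f : bridge_profile sg -> w != 0 ->
  sorted <%R X -> {in X, forall x, 0 < x < 1} ->
  exists s, interpolates (profile_kernel sg w) X f s.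
Proof.
move=> sgP w0; elim: X => [|x X IH] srt X01.
  by exists (fun=> 0); split => //; exists (fun=> 0); apply/funext=> t; rewrite big_nil.
have [s sX [sx s0]] := profile_cardinal sgP w0 srt X01.
have [|r [rX rf]] := IH (path_sorted srt).
  by move=> y yX; apply: X01; rewrite inE yX orbT.
have xX : x \notin X.
  by have := sorted_uniq lt_trans ltxx srt; rewrite /= => /andP[].
exists (fun t => r t + (f x - r x) / s x * s t); split.
  by apply: kernel_span_lincomb => //; exact: kernel_span_cons.
move=> y; rewrite inE => /predU1P[->|yX]; first by field.
by rewrite (s0 _ yX) mulr0 addr0 rf.
Qed.

End Kernel.

(** * Adjacent nodes and the fill distance *)

Section Nodes.
Context {R : realType}.
Implicit Types (X : seq R) (t a b : R).

(** Adding a point to [X] changes the bracket only if it falls strictly inside; it then replaces the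
    end on its side of [t]. The half-open form forces [a < b]. *)
Lemma adjacent_nodes X lo hi t : lo <= t < hi ->
  exists a b, [/\ a \in lo :: X, b \in hi :: X, a <= t < b &
    {in X, forall x, x <= a \/ b <= x}].
Proof.
move=> lth; elim: X => [|x X [a [b [aX bX /andP[at' tb] sep]]]].
  by exists lo, hi; rewrite !mem_head.
have sub u v : u \in v :: X -> u \in v :: x :: X.
  by rewrite !inE => /orP[->//|->]; rewrite !orbT.
have [xa|ax] := leP x a.
  exists a, b; split; rewrite ?(sub _ _ aX) ?(sub _ _ bX) ?at'// => y.
  by rewrite inE => /predU1P[->|/sep//]; left.
have [bx|xb] := leP b x.
  exists a, b; split; rewrite ?(sub _ _ aX) ?(sub _ _ bX) ?at'// => y.
  by rewrite inE => /predU1P[->|/sep//]; right.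
have [xt|tx] := leP x t.
  exists x, b; split; rewrite ?(sub _ _ bX) ?xt ?inE ?eqxx ?orbT// => y.
  rewrite inE => /predU1P[->|/sep[ya|]]; [by left| |by right].
  by left; rewrite (le_trans ya) ?ltW.
exists a, x; split; rewrite ?(sub _ _ aX) ?(sub _ _ bX) ?at' ?inE ?eqxx ?orbT// => y.
rewrite inE => /predU1P[->|/sep[|xy]]; [by right|by left|].
by right; rewrite (le_trans _ xy) ?ltW.
Qed.

Lemma half_gap_le_fill_distance X a b : 0 <= a -> a < b -> b <= 1 ->
  {in X, forall x, x <= a \/ b <= x} -> (b - a) / 2 <= fill_distance X.
Proof.
move=> a0 ab b1 sep; set m := (a + b) / 2.
apply: (@le_trans _ _ (dist_to_nodes X m)).
  rewrite /dist_to_nodes big_seq; apply: le_bigmin => [|y yX].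
    (* The seed of the minimum is [m] itself, at least half the gap because [0 <= a]. *)
    by rewrite ger0_norm /m; lra.
  have [ya|yb] : y <= a \/ b <= y.
    move: yX; rewrite /nodes inE mem_rcons inE.
    by move=> /predU1P[->|/predU1P[->|/sep//]]; [left|right].
  - by rewrite ger0_norm /m; lra.
  - by rewrite ler0_norm /m; lra.
apply: ub_le_sup; last first.
  by exists m => //=; rewrite in_itv/= /m; apply/andP; split; lra.
(* The supremum needs an upper bound: the seed is below 1. *)
exists 1 => _ [t + <-]; rewrite /= in_itv/= => /andP[t0 t1].
by rewrite (le_trans (bigmin_le_id _ _ _ _))// ger0_norm ltW.
Qed.

End Nodes.

(** * Bounds for the two norms *)

Lemma max_norm_on_ge0 {R : realType} (X : seq R) f : 0 <= max_norm_on X f.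
Proof. exact: bigmax_ge_id. Qed.

Lemma le_max_norm_on {R : realType} (X : seq R) f x : x \in X ->
  `|f x| <= max_norm_on X f.
Proof. by move=> xX; exact: (@Order.TotalTheory.le_bigmax_seq _ _ _ _ _ _ xpredT (fun y => `|f y|)). Qed.

Lemma Linfty_norm_le {R : realType} (g : R -> R) (c : R) : 0 <= c ->
  (forall t, 0 < t < 1 -> `|g t| <= c) -> (Linfty_norm g <= c%:E)%E.
Proof.
move=> c0 gc; rewrite /Linfty_norm unlock.
(* The second branch of the norm is the constant 0, covered by [0 <= c], as is the zero extension
   below. *)
case: ifP => _; last by rewrite lee_fin.
apply/ess_supP; apply: nearW => t /=; rewrite patchE.
by case: ifPn; rewrite ?abse0 ?lee_fin// inE/= in_itv/= => /gc.
Qed.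

(** * Comparison of the two interpolants *)

Section Comparison.
Context {R : realType}.
Implicit Types (eps a b t p q M : R).

(* The hyperbolic weights are dominated by the linear ones, which sum to 1, and
   their own sum is at least [1 - (eps * (b - a) / 2) ^+ 2]. *)
Lemma sinh_linear_blend eps a b t p q M : 0 < eps -> a < b -> a <= t <= b ->
  `|p| <= M -> `|q| <= M ->
  `|(sinh (eps * (b - t)) * p + sinh (eps * (t - a)) * q) / sinh (eps * (b - a))
    - ((b - t) * p + (t - a) * q) / (b - a)|
  <= (eps * (b - a) / 2) ^+ 2 * M.
Proof.
move=> e0 ab /andP[at' tb] pM qM.
set u := t - a; set v := b - t.
have u0 : 0 <= u by rewrite /u; lra.
have v0 : 0 <= v by rewrite /v; lra.
have h0 : 0 < b - a by lra.
have -> : b - a = v + u by rewrite /u /v; ring.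
have {h0} h0 : 0 < v + u by rewrite /u /v; lra.
set S := sinh (eps * (v + u)).
have S0 : 0 < S by rewrite sinh_gt0// mulr_gt0.
have chord w : 0 <= w -> w <= v + u -> sinh (eps * w) / S <= w / (v + u).
  move=> w0 wh; rewrite ler_pdivrMr// [w / _ * _]mulrAC ler_pdivlMr//.
  have := @sinh_chord_le _ (eps * w) (eps * (v + u)).
  rewrite mulr_ge0 ?ler_pM2l ?(ltW e0)// => /(_ isT wh).
  by rewrite -!(mulrA eps) ler_pM2l// -/S [_ * sinh _]mulrC.
have := chord v v0; have := chord u u0.
set Pv := sinh (eps * v) / S; set Pu := sinh (eps * u) / S.
set Lv := v / (v + u); set Lu := u / (v + u) => hu hv.
have {}hu : Pu <= Lu by apply: hu; lra.
have {}hv : Pv <= Lv by apply: hv; lra.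
have L1 : Lv + Lu = 1 by rewrite /Lv /Lu; field; rewrite gt_eqF.
have P1 : 1 - (eps * (v + u) / 2) ^+ 2 <= Pv + Pu.
  rewrite /Pv /Pu -mulrDl ler_pdivlMr// /S mulrDr.
  by apply: sinh_add_ge; rewrite mulr_ge0// ltW.
have -> : (sinh (eps * v) * p + sinh (eps * u) * q) / S
    - (v * p + u * q) / (v + u) = - ((Lv - Pv) * p + (Lu - Pu) * q).
  by rewrite /Lv /Lu /Pv /Pu; field; rewrite !gt_eqF.
rewrite normrN (le_trans (ler_normD _ _))// !normrM (@ger0_norm _ (Lv - Pv)) ?(@ger0_norm _ (Lu - Pu)) ?subr_ge0//.
have M0 : 0 <= M by exact: le_trans pM.
(* The coefficients are nonnegative with sum [1 - (Pv + Pu)], which [P1] bounds. *)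
apply: (@le_trans _ _ ((Lv - Pv) * M + (Lu - Pu) * M)).
  by apply: lerD; rewrite ler_wpM2l ?subr_ge0.
by rewrite -mulrDl ler_wpM2r//; lra.
Qed.

Lemma interpolant_diff_le (X : seq R) (f : R -> R) eps t : sorted <%R X ->
  {in X, forall x, 0 < x < 1} -> 0 < eps -> 0 < t < 1 ->
  `|interpolant (bridge_kernel eps) X f t - interpolant (bridge_kernel 0) X f t|
  <= eps ^+ 2 * fill_distance X ^+ 2 * max_norm_on X f.
Proof.
move=> srt X01 e0 /andP[t0 t1].
rewrite (bridge_kernelE e0) bridge_kernel0E /interpolant.
have sgP := profile_sinh e0; have idP := @profile_id R.
have we : (eps * sinh eps)^-1 != 0.
  by rewrite invr_neq0// mulf_neq0// gt_eqF// sinh_gt0.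
have [? /getI] := interpolates_exists f sgP we srt X01.
set s := get _ => -[sX sf].
have [? /getI] := interpolates_exists f idP (oner_neq0 R) srt X01.
set r := get _ => -[rX rf].
have [s0 s1] := kernel_span_boundary sgP sX X01.
have [r0 r1] := kernel_span_boundary idP rX X01.
have [|a [b [aX bX /andP[at' tb] sep]]] := @adjacent_nodes _ X 0 1 t.
  by rewrite ltW.
have tab : a <= t <= b by rewrite at' ltW.
have ab : a < b by exact: le_lt_trans tb.
have a0 : 0 <= a by move: aX; rewrite inE => /predU1P[->//|/X01/andP[/ltW]].
have b1 : b <= 1 by move: bX; rewrite inE => /predU1P[->//|/X01/andP[_ /ltW]].
have M0 := max_norm_on_ge0 X f.
(* At a bracket end both interpolants agree: the common value is the datum at a point of [X], or 0
   at the boundary. *)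
have [ra sa] : r a = s a /\ `|s a| <= max_norm_on X f.
  move: aX; rewrite inE => /predU1P[->|aX]; first by rewrite r0 s0 normr0.
  by rewrite rf// sf//; split => //; exact: le_max_norm_on.
have [rb sb] : r b = s b /\ `|s b| <= max_norm_on X f.
  move: bX; rewrite inE => /predU1P[->|bX]; first by rewrite r1 s1 normr0.
  by rewrite rf// sf//; split => //; exact: le_max_norm_on.
have S0 : sinh (eps * (b - a)) != 0.
  by rewrite gt_eqF// sinh_gt0// mulr_gt0// subr_gt0.
have ba0 : b - a != 0 by rewrite gt_eqF// subr_gt0.
have -> : s t = (sinh (eps * (b - t)) * s a + sinh (eps * (t - a)) * s b)
    / sinh (eps * (b - a)).
  by rewrite -(kernel_span_between sgP sX tab sep) mulrC mulKf.
have -> : r t = ((b - t) * s a + (t - a) * s b) / (b - a).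
  by rewrite -ra -rb -(kernel_span_between idP rX tab sep) mulrC mulKf.
rewrite (le_trans (sinh_linear_blend e0 ab tab sa sb))// ler_wpM2r//.
rewrite -exprMn -mulrA ler_pXn2r// ?nnegrE; last 2 first.
- by rewrite mulr_ge0 ?(ltW e0)//; lra.
- rewrite mulr_ge0 ?(ltW e0)// (le_trans _ (half_gap_le_fill_distance a0 ab b1 sep))//.
  by lra.
by rewrite ler_pM2l// half_gap_le_fill_distance.
Qed.

End Comparison.

Theorem theorem6 (R : realType) (N : nat) (hN : (1 <= N)%N)
    (X : N.-tuple R) (X_sorted : sorted <%R X)
    (X01 : forall x : R, x \in X -> 0 < x < 1)
    (eps : R) (eps_gt0 : 0 < eps)
    (f : R -> R) (f_cont : {within `]0, 1[%classic, continuous f}) :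
  (Linfty_norm (interpolant (bridge_kernel eps) X f
                \- interpolant (bridge_kernel 0) X f)%R
   <= (8 / 3 * eps ^+ 2 * fill_distance X ^+ 2 * max_norm_on X f)%:E)%E.
Proof.
(* Nonnegativity allows the constant 1 to be relaxed to 8/3. *)
have B0 : 0 <= eps ^+ 2 * fill_distance X ^+ 2 * max_norm_on X f.
  by rewrite mulr_ge0 ?max_norm_on_ge0// -exprMn sqr_ge0.
apply: Linfty_norm_le => [|t t01 /=]; first by lra.
by have := interpolant_diff_le f X_sorted X01 eps_gt0 t01; lra.
Qed.
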